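(* Every connected graph $G$ has a tree-cut decomposition $(T,\mathcal X)$, $\mathcal X=\{X_t: t\in V(T)\}$, of finite adhesion whose parts are exactly the $\omega$-edge blocks of $G$, and such that for every edge $t_1t_2\in E(T)$ there exists an edge of $G$ between $X_{t_1}$ and $X_{t_2}$.
   Context: Two vertices $x,y$ of $G$ are finitely separable if some finite set of edges separates them in $G$. Writing $x\sim y$ if $x,y$ are not finitely separable gives an equivalence relation on $V(G)$ whose classes are the $\omega$-edge blocks of $G$. A tree-cut decomposition of $G$ is a pair $(T,\mathcal X)$ where $T$ is a tree and $\mathcal X=\{X_t:t\in V(T)\}$ is a partition of $V(G)$ into nonempty sets (parts) indexed by the nodes of $T$. For an edge $e=t_1t_2$ of $T$ with $T_1\ni t_1$, $T_2\ni t_2$ the components of $T-e$, its adhesion set is $X_e=E_G(\bigcup_{t\in T_1}X_t,\bigcup_{t\in T_2}X_t)$. The decomposition has finite adhesion if all adhesion sets are finite. *)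

(* Defs.v *)
From Stdlib Require Import List Relations.
Import ListNotations.
Set Implicit Arguments.

Record graph := Graph {
  vert :> Type;
  adj : vert -> vert -> Prop;
  adj_sym : forall u v, adj u v -> adj v u;
  adj_irrefl : forall u, ~ adj u u }.

Definition reach (G : graph) : G -> G -> Prop := clos_refl_trans G (@adj G).

Definition connected (G : graph) : Prop :=
  inhabited G /\ forall x y : G, reach G x y.

(* A finite set of edges is given by a list of (ordered) pairs; the edge
   {u,v} belongs to F if (u,v) or (v,u) is listed. *)
Definition in_edges (G : graph) (F : list (G * G)) (u v : G) : Prop :=
  In (u, v) F \/ In (v, u) F.

Definition adj_minus (G : graph) (F : list (G * G)) (u v : G) : Prop :=
  adj G u v /\ ~ @in_edges G F u v.

Definition finitely_separable (G : graph) (x y : G) : Prop :=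
  exists F : list (G * G), ~ clos_refl_trans G (@adj_minus G F) x y.

(* x ~ y : not finitely separable; its classes are the omega-edge blocks *)
Definition omega_equiv (G : graph) (x y : G) : Prop := ~ @finitely_separable G x y.

Fixpoint chain (G : graph) (l : list G) : Prop :=
  match l with
  | x :: ((y :: _) as l') => adj G x y /\ @chain G l'
  | _ => True
  end.

Definition is_cycle (G : graph) (l : list G) : Prop :=
  3 <= length l /\ NoDup l /\ @chain G l /\
  exists x0, hd_error l = Some x0 /\ adj G (last l x0) x0.

Definition is_tree (T : graph) : Prop :=
  connected T /\ forall l : list T, ~ @is_cycle T l.

Definition finite_pairs (A B : Type) (P : A -> B -> Prop) : Prop :=
  exists l : list (A * B), forall a b, P a b -> In (a, b) l.

(* Tree-cut decomposition of G over the tree T, encoded by the map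
   part : V(G) -> V(T) sending each vertex to the index of its part
   X_t = { v | part v = t }.  Parts form a partition of V(G) by
   construction; nonemptiness of every part = surjectivity of part. *)
Definition tree_cut_decomposition (G T : graph) (part : G -> T) : Prop :=
  is_tree T /\ forall t : T, exists v : G, part v = t.

Definition adj_minus_edge (T : graph) (t1 t2 : T) (u v : T) : Prop :=
  adj T u v /\ ~ ((u = t1 /\ v = t2) \/ (u = t2 /\ v = t1)).

Definition side (T : graph) (t1 t2 s : T) : T -> Prop :=
  fun t => clos_refl_trans T (@adj_minus_edge T t1 t2) s t.

Definition adhesion (G T : graph) (part : G -> T) (t1 t2 : T) (x y : G) : Prop :=
  adj G x y /\ @side T t1 t2 t1 (part x) /\ @side T t1 t2 t2 (part y).

Definition finite_adhesion (G T : graph) (part : G -> T) : Prop :=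
  forall t1 t2 : T, adj T t1 t2 -> finite_pairs (@adhesion G T part t1 t2).

(* Main.v *)
Require Import Defs.
From Stdlib Require Import List Relations.
From Stdlib Require Import Arith Lia Classical ClassicalEpsilon.
From Stdlib Require Import FunctionalExtensionality PropExtensionality.
Import ListNotations.

(** Contract every omega-edge block to a point: in the resulting connected graph [H]
    any two vertices are separated by a vertex set with finite boundary, and we need a
    spanning tree of [H] all of whose fundamental cuts are finite.

    Such a tree is grown from a root by repeatedly splitting a connected vertex set [B]
    of finite boundary with a chosen root [b]: partition [B - b] into connected sets of
    finite boundary, each adjacent to [b], and make a neighbour of [b] the root of each.
    The descendants of a vertex then form one of these sets, so fundamental cuts are
    finite. The partition of a component of [B - b] is found by exhaustion: cut off a
    connected set of finite boundary that touches [b], contains all ends of boundary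
    edges not going to [b], and leaves only components adjacent to [b]; then continue
    in these components. A vertex at distance [k] from the first set is reached after
    at most [k] rounds.

    Every vertex eventually becomes a root because one of the sets always contains a
    shortest path in [B] from [b] to the vertices of [B] closest to the global root.
    There are only finitely many of these, since they are ends of boundary edges of [B],
    so each of them is in turn split off or reached. *)

(** * Extensionality, choice and least numbers *)

Lemma set_ext (A : Type) (P Q : A -> Prop) : (forall x, P x <-> Q x) -> P = Q.
Proof.
  intros E. apply functional_extensionality; intros x.
  apply propositional_extensionality, E.
Qed.

Lemma choice_fun (A B : Type) (P : A -> B -> Prop) :
  (forall a, exists b, P a b) -> exists f, forall a, P a (f a).
Proof.
  intros E. exists (fun a => proj1_sig (constructive_indefinite_description _ (E a))).
  intros a. apply proj2_sig.
Qed.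

Lemma least_nat (P : nat -> Prop) :
  (exists n, P n) -> exists n, P n /\ forall m, m < n -> ~ P m.
Proof.
  intros [n Hn]. induction n as [n IH] using lt_wf_ind.
  destruct (classic (exists m, m < n /\ P m)) as [[m [Hm Pm]]|H].
  - eauto.
  - exists n. split; [assumption|]. intros m Hm Pm. apply H. eauto.
Qed.

(** * Finite binary relations *)

Section FinitePairs.
Variables A B : Type.

Lemma finite_pairs_sub (P Q : A -> B -> Prop) :
  (forall a b, P a b -> Q a b) -> finite_pairs Q -> finite_pairs P.
Proof. intros S [l Hl]. exists l. auto. Qed.

Lemma finite_pairs_or (P Q : A -> B -> Prop) :
  finite_pairs P -> finite_pairs Q -> finite_pairs (fun a b => P a b \/ Q a b).
Proof.
  intros [l Hl] [m Hm]. exists (l ++ m). intros a b H. apply in_or_app.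
  destruct H; auto.
Qed.

Lemma finite_pairs_swap (P : A -> B -> Prop) :
  finite_pairs P -> finite_pairs (fun b a => P a b).
Proof.
  intros [l Hl]. exists (map (fun p => (snd p, fst p)) l). intros b a H.
  apply in_map_iff. exists (a, b). auto.
Qed.

(** [P] is the union of its fibres over the listed pairs. A listed pair outside [Q] has empty fibre,
    whence the case distinction. *)
Lemma finite_pairs_fibres (C D : Type) (f : A -> C) (g : B -> D)
    (P : A -> B -> Prop) (Q : C -> D -> Prop) :
  (forall a b, P a b -> Q (f a) (g b)) -> finite_pairs Q ->
  (forall c d, Q c d -> finite_pairs (fun a b => P a b /\ f a = c /\ g b = d)) ->
  finite_pairs P.
Proof.
  intros PQ [l Hl] fib.
  assert (K : forall m, finite_pairs (fun a b => P a b /\ In (f a, g b) m)).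
  { induction m as [|[c d] m IH].
    - exists nil. intros a b [_ []].
    - destruct (classic (Q c d)) as [q|nq].
      + apply finite_pairs_sub with (2 := finite_pairs_or _ _ (fib c d q) IH).
        intros a b [p [e|i]]; [left; injection e as -> ->|right]; auto.
      + apply finite_pairs_sub with (2 := IH). intros a b [p [e|i]]; [|auto].
        injection e as -> ->. destruct nq. auto. }
  apply finite_pairs_sub with (2 := K l). auto.
Qed.
End FinitePairs.

(** * Walks, components and boundaries in induced subgraphs *)

Section Walks.
Variable H : graph.
Implicit Types (A B C D : H -> Prop) (x y z : H).

Inductive walk A : nat -> H -> H -> Prop :=
| walk_nil x : A x -> walk A 0 x x
| walk_cons n x y z : A x -> adj H x y -> walk A n y z -> walk A (S n) x z.

Definition linked A x y := exists n, walk A n x y.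
Definition conn A := forall x y, A x -> A y -> linked A x y.
Definition boundary A x y := adj H x y /\ A x /\ ~ A y.
Definition finite_boundary A := finite_pairs (boundary A).
Definition setU A B x := A x \/ B x.
Definition setI A B x := A x /\ B x.
Definition setD A B x := A x /\ ~ B x.
Definition incl_set A B := forall x, A x -> B x.

Lemma walk_sub A B n x y : incl_set A B -> walk A n x y -> walk B n x y.
Proof. intros S w. induction w; econstructor; eauto. Qed.

Lemma walk_src A n x y : walk A n x y -> A x.
Proof. now destruct 1. Qed.

Lemma walk_tgt A n x y : walk A n x y -> A y.
Proof. induction 1; auto. Qed.

Lemma linked_sub A B x y : incl_set A B -> linked A x y -> linked B x y.
Proof. intros S [n w]. exists n. eapply walk_sub; eauto. Qed.

Lemma linked_refl A x : A x -> linked A x x.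
Proof. exists 0. now constructor. Qed.

Lemma linked_step A x y z : A x -> adj H x y -> linked A y z -> linked A x z.
Proof. intros a e [n w]. exists (S n). econstructor; eauto. Qed.

Lemma linked_trans A x y z : linked A x y -> linked A y z -> linked A x z.
Proof. intros [n w] L. induction w; [assumption|]. eapply linked_step; eauto. Qed.

Lemma linked_adj A x y : A x -> A y -> adj H x y -> linked A x y.
Proof. intros. eapply linked_step; eauto using linked_refl. Qed.

Lemma linked_sym A x y : linked A x y -> linked A y x.
Proof.
  intros [n w]. induction w as [x a|n x y z a e w IH]; [now apply linked_refl|].
  eapply linked_trans; [exact IH|].
  apply linked_adj; auto using adj_sym. exact (walk_src _ _ _ _ w).
Qed.

Lemma linked_src A x y : linked A x y -> A x.
Proof. intros [n w]. eapply walk_src; eauto. Qed.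

Lemma linked_tgt A x y : linked A x y -> A y.
Proof. intros [n w]. eapply walk_tgt; eauto. Qed.

Lemma linked_eq A x y : linked A x y -> linked A x = linked A y.
Proof.
  intros L. apply set_ext; intros z.
  split; intros; eapply linked_trans; eauto using linked_sym.
Qed.

Lemma linked_component A x y : linked A x y -> linked (linked A x) x y.
Proof.
  intros [n w]. revert x w. induction n as [|n IH]; intros x w; inversion w; subst.
  - now apply linked_refl, linked_refl.
  - assert (L : linked A x y0).
    { apply linked_adj; auto. eapply walk_src; eauto. }
    apply linked_step with (y := y0); auto.
    + now apply linked_refl.
    + rewrite (linked_eq _ _ _ L). auto.
Qed.

Lemma conn_component A x : conn (linked A x).
Proof.
  intros y z Ly Lz. eapply linked_trans; [apply linked_sym|]; apply linked_component; auto.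
Qed.

Lemma conn_of_hub A x : (forall y, A y -> linked A y x) -> conn A.
Proof. intros h y z a b. eapply linked_trans; eauto using linked_sym. Qed.

Lemma conn_setU A B x y :
  conn A -> conn B -> A x -> B y -> x = y \/ adj H x y -> conn (setU A B).
Proof.
  intros cA cB a b e.
  assert (SA : incl_set A (setU A B)) by (intros ? ?; now left).
  assert (SB : incl_set B (setU A B)) by (intros ? ?; now right).
  assert (L : linked (setU A B) x y).
  { destruct e as [<-|e]; [now apply linked_refl, SA|].
    apply linked_adj; auto. }
  apply conn_of_hub with y. intros z [az|bz].
  - eapply linked_trans; [|exact L]. apply linked_sub with A; auto.
  - apply linked_sub with B; auto.
Qed.

Lemma boundary_component A v x y : boundary (linked A v) x y -> boundary A x y.
Proof.
  intros [e [L N]]. split; [assumption|]. assert (a := linked_tgt _ _ _ L).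
  split; [assumption|]. intros b. apply N. eapply linked_trans; [exact L|].
  now apply linked_adj.
Qed.

(** A walk through [b] contains a walk from [b] that is no longer; so a shortest walk from [b] never
    returns to [b]. *)
Lemma walk_avoid A b n x y :
  walk A n x y -> walk (setD A (eq b)) n x y \/ exists m, m <= n /\ walk A m b y.
Proof.
  induction 1 as [x a|n x y z a e w IH].
  - destruct (classic (b = x)) as [->|nb].
    + right. exists 0. split; [lia|now constructor].
    + left. now constructor.
  - destruct (classic (b = x)) as [->|nb].
    + right. exists (S n). split; [lia|]. econstructor; eauto.
    + destruct IH as [w'|[m [le w']]].
      * left. econstructor; eauto. now split.
      * right. exists m. auto with arith.
Qed.

(** Lists the vertices of a walk, so that prescribing finitely many vertices of a set keeps the
    whole walk inside it. *)
Lemma walk_support A n x y : walk A n x y ->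
  exists l, (forall z, In z l -> linked A x z) /\ In x l /\ In y l /\
    forall D, (forall z, In z l -> D z) -> walk D n x y.
Proof.
  induction 1 as [x a|n x y z a e w [l [lA [lx [ly lw]]]]].
  - exists [x]. simpl. repeat split; auto.
    + intros z [<-|[]]. now apply linked_refl.
    + intros D hD. constructor. auto.
  - exists (x :: l). simpl. repeat split; auto.
    + intros t [<-|i]; [now apply linked_refl|]. eapply linked_step; eauto.
    + intros D hD. econstructor; eauto.
Qed.

(** Stop a walk from [v] to [b] just before its first visit to [b]. *)
Lemma linked_to_neighbour B b v : conn B -> B b -> B v -> v <> b ->
  exists s, linked (setD B (eq b)) v s /\ adj H s b.
Proof.
  intros cB Bb Bv nv. destruct (cB v b Bv Bb) as [n w].
  induction w as [x a|n x y z a e w IH]; [congruence|].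
  destruct (classic (y = z)) as [->|ne].
  - exists x. split; [apply linked_refl; split; congruence|assumption].
  - destruct IH as [s [L es]]; auto; [eapply walk_src; eauto|].
    exists s. split; [|assumption].
    eapply linked_step; eauto. split; congruence.
Qed.

End Walks.

(** * Iterated refinement, followed vertex by vertex *)

Section Iteration.
Variables (V St : Type) (U : V -> Prop) (Valid : St -> Prop).
Variables (body core : St -> V -> Prop) (nxt : St -> V -> St) (s0 : V -> St).

(** Stationary once [v] lies in the core. Used twice: with regions and the sets cut off from them to
    form pieces, and with branches, whose core is the root, to grow the tree. *)
Fixpoint state v n : St :=
  match n with
  | 0 => s0 v
  | S n => let s := state v n in
           if excluded_middle_informative (core s v) then s else nxt s v
  end.

Definition unsettled v n := forall m, m < n -> ~ core (state v m) v.
Definition settles v n := core (state v n) v /\ unsettled v n.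

Hypothesis s0_valid : forall v, U v -> Valid (s0 v) /\ body (s0 v) v.
Hypothesis s0_eq : forall v w, U v -> body (s0 v) w -> s0 w = s0 v.
Hypothesis nxt_valid : forall s v, Valid s -> body s v -> ~ core s v ->
  Valid (nxt s v) /\ body (nxt s v) v.
Hypothesis nxt_eq : forall s v w, Valid s -> body s v -> ~ core s v ->
  body (nxt s v) w -> body s w /\ ~ core s w /\ nxt s w = nxt s v.

Lemma state_valid v n : U v -> Valid (state v n) /\ body (state v n) v.
Proof.
  intros u. induction n as [|n [IH1 IH2]]; simpl; [auto|].
  destruct excluded_middle_informative; auto.
Qed.

Lemma state_S v n : ~ core (state v n) v -> state v (S n) = nxt (state v n) v.
Proof. intros N. simpl. now destruct excluded_middle_informative. Qed.

Lemma state_sub v m n w : U v -> m <= n -> body (state v n) w -> body (state v m) w.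
Proof.
  intros u le. induction le as [|n le IH]; [auto|]. simpl.
  destruct (state_valid v n u) as [val bd].
  destruct excluded_middle_informative; [auto|].
  intros b. apply IH. eapply nxt_eq; eauto.
Qed.

(** By [nxt_eq], a vertex still in the body of [v] was in no earlier core and always passed to the
    same next state, so both share one history. *)
Lemma state_agree v n w : U v -> unsettled v n -> body (state v n) w ->
  state w n = state v n /\ unsettled w n.
Proof.
  intros u. induction n as [|n IH]; intros uns b.
  - split; [now apply s0_eq|]. intros m lt. lia.
  - destruct (IH (fun m lt => uns m (Nat.lt_lt_succ_r _ _ lt))
        (state_sub _ _ _ _ u (Nat.le_succ_diag_r n) b)) as [E uw].
    assert (nc := uns n (Nat.lt_succ_diag_r n)).
    destruct (state_valid v n u) as [val bd].
    rewrite (state_S v n nc) in *.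
    destruct (nxt_eq _ _ _ val bd nc b) as [_ [ncw Ew]].
    rewrite <- E in ncw. split.
    + rewrite (state_S w n ncw), E. exact Ew.
    + intros m lt. destruct (Nat.eq_dec m n) as [->|]; [assumption|]. apply uw. lia.
Qed.

Lemma settles_unique v m n : settles v m -> settles v n -> m = n.
Proof.
  intros [c1 u1] [c2 u2]. destruct (Nat.lt_trichotomy m n) as [h|[h|h]]; auto.
  - destruct (u2 _ h c1).
  - destruct (u1 _ h c2).
Qed.

Lemma settles_ex v : (exists n, core (state v n) v) -> exists n, settles v n.
Proof. intros e. apply least_nat in e. exact e. Qed.

(** This is why the cores in which vertices settle form a partition. *)
Lemma settles_agree v n w : U v -> settles v n -> body (state v n) w ->
  core (state v n) w -> settles w n /\ state w n = state v n.
Proof.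
  intros u [c uns] b cw. destruct (state_agree v n w u uns b) as [E uw].
  split; [|assumption]. split; [|assumption]. now rewrite E.
Qed.

End Iteration.

(** * Partitioning [B - b] into connected pieces of finite boundary *)

Section Pieces.
Variable H : graph.
Hypothesis sep : forall x y : H, x <> y ->
  exists Z : H -> Prop, Z x /\ ~ Z y /\ finite_boundary H Z.
Variable b : H.

Local Notation linked := (linked H).
Local Notation conn := (conn H).
Local Notation setU := (setU H).
Local Notation setI := (setI H).
Local Notation setD := (setD H).
Local Notation boundary := (boundary H).
Local Notation finite_boundary := (finite_boundary H).

Definition touches (C : H -> Prop) := exists s, C s /\ adj H s b.

(* Regions are allowed infinitely many edges to [b], but only finitely many others. *)
Definition region (C : H -> Prop) :=
  conn C /\ ~ C b /\ finite_pairs (fun x y => boundary C x y /\ y <> b) /\ touches C.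

Lemma finite_boundary_setU A B :
  finite_boundary A -> finite_boundary B -> finite_boundary (setU A B).
Proof.
  intros fA fB. apply finite_pairs_sub with (2 := finite_pairs_or _ _ _ _ fA fB).
  intros x y [e [[a|a] N]]; [left|right]; repeat split; auto;
    intros h; apply N; [left|right]; exact h.
Qed.

(** Take the component of [s] in [C] intersected with a set [Z] separating [s] from [b]. Its edges
    to [b] all leave [Z], so they are finitely many; any other boundary edge leaves [Z], or leaves
    [C] for a vertex other than [b]. *)
Lemma finite_nbhd C s : ~ C b -> finite_pairs (fun x y => boundary C x y /\ y <> b) ->
  C s -> exists D, conn D /\ finite_boundary D /\ incl_set H D C /\ D s.
Proof.
  intros nb fC Cs. destruct (sep s b) as [Z [Zs [nZ fZ]]]; [congruence|].
  exists (linked (setI C Z) s). split; [apply conn_component|]. split; [|split].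
  - apply finite_pairs_sub with (2 := finite_pairs_or _ _ _ _ fC fZ).
    intros x y hb. apply boundary_component in hb. destruct hb as [e [[c z] N]].
    destruct (classic (Z y)) as [zy|nz]; [left|right; now repeat split].
    split; [|congruence]. split; [assumption|]. split; [assumption|].
    intros cy. now apply N.
  - intros x L. apply linked_tgt in L. apply L.
  - now apply linked_refl.
Qed.

(** Union of the neighbourhoods of the vertices of a walk. *)
Lemma finite_linked_nbhd C s x :
  ~ C b -> finite_pairs (fun x y => boundary C x y /\ y <> b) -> linked C s x ->
  exists D, conn D /\ finite_boundary D /\ incl_set H D C /\ D s /\ D x.
Proof.
  intros nb fC [n w]. induction w as [x a|n x y z a e w IH].
  - destruct (finite_nbhd C x nb fC a) as [D hD]. exists D. intuition.
  - destruct IH as [D [cD [fD [sD [Dy Dz]]]]].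
    destruct (finite_nbhd C x nb fC a) as [E [cE [fE [sE Ex]]]].
    exists (setU E D). split; [|split; [|split; [|split]]].
    + apply conn_setU with x y; auto.
    + now apply finite_boundary_setU.
    + intros t [t1|t1]; auto.
    + now left.
    + now right.
Qed.

Lemma finite_list_nbhd C s l :
  ~ C b -> finite_pairs (fun x y => boundary C x y /\ y <> b) -> conn C -> C s ->
  exists D, conn D /\ finite_boundary D /\ incl_set H D C /\ D s /\
    forall x, In x l -> C x -> D x.
Proof.
  intros nb fC cC Cs. induction l as [|x l [D [cD [fD [sD [Ds Dl]]]]]].
  - destruct (finite_nbhd C s nb fC Cs) as [D hD]. exists D. simpl. intuition.
  - destruct (classic (C x)) as [Cx|nC].
    + destruct (finite_linked_nbhd C s x nb fC (cC s x Cs Cx))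
        as [E [cE [fE [sE [Es Ex]]]]].
      exists (setU E D). split; [|split; [|split; [|split]]].
      * apply conn_setU with s s; auto.
      * now apply finite_boundary_setU.
      * intros t [t1|t1]; auto.
      * now left.
      * intros t [<-|i] Ct; [now left|right; auto].
    + exists D. repeat (split; [assumption|]). intros t [<-|i] Ct; [contradiction|auto].
Qed.

(** [W] lists vertices to be kept together. The clause on boundary edges forces a vertex adjacent to
    the core just removed into the next core; the last clause makes every leftover component a
    region again. *)
Definition is_core (W : list H) (C D : H -> Prop) :=
  conn D /\ finite_boundary D /\ incl_set H D C /\ touches D /\
  (forall x, In x W -> C x -> D x) /\
  (forall x y, boundary C x y -> y <> b -> D x) /\
  (forall v, C v -> ~ D v -> touches (linked (setD C D) v)).

(* Start from a finite-boundary connected set [E] containing the finitely many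
   prescribed vertices, and add the components of [C - E] not adjacent to [b]. *)
Lemma core_exists W C : region C -> exists D, is_core W C D.
Proof.
  intros [cC [nb [fC [s [Cs es]]]]]. destruct fC as [l hl].
  destruct (finite_list_nbhd C s (W ++ map fst l) nb (ex_intro _ l hl) cC Cs)
    as [E [cE [fE [sE [Es El]]]]].
  assert (EW : forall x, In x W -> C x -> E x)
    by (intros; apply El; auto using in_or_app).
  assert (Eb : forall x y, boundary C x y -> y <> b -> E x).
  { intros x y hb ny. apply El; [|apply hb]. apply in_or_app. right.
    apply in_map_iff. exists (x, y). split; [reflexivity|]. auto. }
  clear El.
  set (bad := fun v => setD C E v /\ ~ touches (linked (setD C E) v)).
  assert (badS : forall x y, bad x -> linked (setD C E) x y -> bad y).
  { intros x y [h1 h2] L. split; [eapply linked_tgt; eauto|].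
    now rewrite <- (linked_eq _ _ _ _ L). }
  exists (setU E bad). repeat split.
  - apply conn_of_hub with s. intros v [Ev|bv].
    { apply linked_sub with E; [now left|]. auto. }
    assert (Cv : C v) by apply bv.
    destruct (cC v s Cv Cs) as [n w].
    induction w as [x a|n x y z a e w IH]; [destruct bv as [[_ bv] _]; contradiction|].
    apply linked_step with y; [now right|assumption|].
    assert (Cy := walk_src _ _ _ _ _ w).
    destruct (classic (E y)) as [Ey|nE].
    + apply linked_sub with E; [now left|]. auto.
    + apply IH; auto. apply badS with x; auto.
      apply linked_adj; auto; [apply bv|now split].
  - apply finite_pairs_sub with (2 := fE).
    intros x y [e [[Ex|bx] N]].
    { repeat split; auto. intros h. apply N. now left. }
    (* No boundary edge starts at a bad vertex: its end in [C] would be bad too, an end [b] would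
       make the component touch [b], and any other end would put [x] into [E]. *)
    exfalso. destruct (classic (C y)) as [Cy|nC].
    + assert (nE : ~ E y) by (intros h; apply N; now left).
      apply N. right. apply badS with x; auto.
      apply linked_adj; auto; [apply bx|now split].
    + destruct (classic (y = b)) as [->|ny].
      * apply (proj2 bx). exists x. split; [|assumption]. apply linked_refl, bx.
      * destruct bx as [[h1 h2] _]. apply h2, (Eb x y); auto. now repeat split.
  - intros x [h|h]; [auto|apply h].
  - exists s. split; [now left|assumption].
  - intros. left. auto.
  - intros. left. eauto.
  - intros v Cv nD.
    assert (nE : ~ E v) by (intros h; apply nD; now left).
    destruct (classic (touches (linked (setD C E) v))) as [[t [L et]]|nt].
    + exists t. split; [|assumption].
      apply linked_component in L. apply linked_sub with (2 := L).
      intros x Lx. split; [apply linked_tgt in Lx; apply Lx|]. intros [h|h].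
      * apply linked_tgt in Lx. destruct Lx. contradiction.
      * apply nD. right. apply badS with x; auto using linked_sym.
    + destruct nD. right. split; auto. now split.
Qed.

Lemma region_component B v : conn B -> finite_boundary B -> B b -> B v -> v <> b ->
  region (linked (setD B (eq b)) v).
Proof.
  intros cB fB Bb Bv nv. split; [apply conn_component|]. split; [|split].
  - intros L. apply linked_tgt in L. now destruct L.
  - apply finite_pairs_sub with (2 := fB). intros x y [h ny].
    apply boundary_component in h. destruct h as [e [[Bx nx] N]].
    repeat split; auto. intros By. apply N. split; auto.
  - destruct (linked_to_neighbour _ B b v) as [s [L e]]; auto. now exists s.
Qed.

(** An edge leaving such a component ends in [D], whose boundary is finite, or outside [C], where
    all but finitely many edges go to [b]. *)
Lemma region_next W C D v : region C -> is_core W C D -> C v -> ~ D v ->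
  region (linked (setD C D) v).
Proof.
  intros [cC [nb [fC tC]]] [cD [fD [sD [tD [_ [_ h]]]]]] Cv nD.
  split; [apply conn_component|]. split; [|split].
  - intros L. apply linked_tgt in L. now destruct L.
  - apply finite_pairs_sub with
      (2 := finite_pairs_or _ _ _ _ fC (finite_pairs_swap _ _ _ fD)).
    intros x y [hb ny]. apply boundary_component in hb. destruct hb as [e [[Cx nx] N]].
    destruct (classic (C y)) as [Cy|nC]; [right|left; now repeat split].
    repeat split; auto using adj_sym. apply NNPP. intros nDy. apply N. now split.
  - now apply h.
Qed.

(** The piece of [v] is the core in which [v] settles when cores are repeatedly cut off from its
    component of [B - b]. All of [W] falls into the first core of the component of [p]. *)
Lemma piece_partition B W p : conn B -> finite_boundary B -> B b ->
  In p W -> (forall x, In x W -> linked (setD B (eq b)) p x) ->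
  exists piece : H -> H -> Prop,
    (forall x, In x W -> piece p x) /\
    forall v, B v -> v <> b ->
      piece v v /\ conn (piece v) /\ finite_boundary (piece v) /\ touches (piece v) /\
      forall w, piece v w -> B w /\ w <> b /\ piece w = piece v.
Proof.
  intros cB fB Bb pW hW.
  destruct (choice_fun _ _ (fun C D => region C -> is_core W C D)) as [core hcore].
  { intros C. destruct (classic (region C)) as [r|n].
    - destruct (core_exists W C r) as [D hD]. now exists D.
    - exists C. intros r. contradiction. }
  set (U := setD B (eq b)).
  set (nxt := fun C v => linked (setD C (core C)) v).
  set (s0 := linked U). set (body := fun C : H -> Prop => C).
  assert (A1 : forall v, U v -> region (s0 v) /\ body (s0 v) v).
  { intros v [Bv nv]. split; [apply region_component; auto|].
    apply linked_refl. now split. }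
  assert (A2 : forall v w, U v -> body (s0 v) w -> s0 w = s0 v).
  { intros v w _ L. symmetry. now apply linked_eq. }
  assert (A3 : forall s v, region s -> body s v -> ~ core s v ->
     region (nxt s v) /\ body (nxt s v) v).
  { intros s v r bv nc. split; [apply region_next with W; auto|].
    apply linked_refl. now split. }
  assert (A4 : forall s v w, region s -> body s v -> ~ core s v ->
     body (nxt s v) w -> body s w /\ ~ core s w /\ nxt s w = nxt s v).
  { intros s v w r bv nc L. assert (K := linked_tgt _ _ _ _ L). destruct K.
    split; [assumption|]. split; [assumption|]. symmetry. now apply linked_eq. }
  pose (st := state _ _ core nxt s0).
  (* Settling spreads along walks from a vertex [q] of the first core: a neighbour of a vertex
     settling in round [n] settles by round [n + 1]. *)
  assert (term : forall v, U v -> exists n, settles _ _ core nxt s0 v n).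
  { intros v Uv. apply settles_ex.
    destruct (A1 v Uv) as [rg _]. destruct (hcore _ rg) as [_ [_ [sub [[q [cq _]] _]]]].
    assert (L : linked U q v) by (apply linked_sym; exact (sub q cq)).
    assert (Q : exists n, settles _ _ core nxt s0 q n).
    { exists 0. split; [|intros m lt; lia]. simpl.
      replace (s0 q) with (s0 v); [assumption|]. symmetry. apply A2; auto. exact (sub q cq). }
    apply linked_sym in L. clear - L Q A1 A2 A3 A4 hcore.
    destruct L as [k w]. induction w as [x a|k x y z a e w IH]; [destruct Q as [n [h _]]; eauto|].
    assert (Uy : U y) by (eapply walk_src; eauto).
    destruct (settles_ex _ _ _ _ _ _ (IH Q)) as [n [cn un]]. clear IH Q w.
    apply NNPP. intros N.
    assert (ux : forall m, ~ core (state _ _ core nxt s0 x m) x) by (intros m c; apply N; eauto).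
    (* If [x] never settled, it would share the state of [y] until round [n], when [y] is cut off.
       Then the edge from [x] to [y] is a boundary edge of the next state of [x], whose core must
       contain [x]. *)
    assert (K : forall m, m <= n -> state _ _ core nxt s0 x m = state _ _ core nxt s0 y m).
    { induction m as [|m IH]; intros le.
      - simpl. apply A2; auto. apply linked_adj; auto. now apply adj_sym.
      - assert (uy := un m le). rewrite !state_S; auto. rewrite IH by lia.
        destruct (state_valid _ _ U region body core nxt s0 A1 A3 x m a) as [rx bx].
        destruct (state_valid _ _ U region body core nxt s0 A1 A3 y m Uy) as [ry by'].
        specialize (ux m). rewrite IH in * by lia.
        symmetry. apply linked_eq. apply linked_adj; [split|split|now apply adj_sym]; auto. }
    specialize (K n (le_n n)).
    destruct (state_valid _ _ U region body core nxt s0 A1 A3 x n a) as [rx bx].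
    destruct (state_valid _ _ U region body core nxt s0 A1 A3 x (S n) a) as [rx' bx'].
    apply (ux (S n)). destruct (hcore _ rx') as [_ [_ [_ [_ [_ [hb _]]]]]].
    apply (hb x y); [|destruct Uy; congruence].
    split; [assumption|]. split; [assumption|].
    rewrite state_S by auto. intros L. apply linked_tgt in L. destruct L as [_ nc].
    apply nc. now rewrite K. }
  destruct (choice_fun _ _ (fun v n => U v -> settles _ _ core nxt s0 v n)) as [N hN].
  { intros v. destruct (classic (U v)) as [u|n]; [|now exists 0].
    destruct (term v u) as [k hk]. now exists k. }
  exists (fun v => core (st v (N v))).
  assert (Up : U p) by (eapply linked_src; apply hW; eauto).
  split.
  - destruct (A1 p Up) as [rp _].
    assert (C0 : forall x, In x W -> core (s0 p) x).
    { intros x i. destruct (hcore _ rp) as [_ [_ [_ [_ [hh _]]]]]. apply hh; auto.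
      apply hW; auto. }
    assert (E : N p = 0).
    { apply (settles_unique _ _ core nxt s0 p); [auto|]. split; [apply C0; auto|].
      intros m lt; lia. }
    rewrite E. exact C0.
  - intros v Bv nv. assert (Uv : U v) by (split; congruence).
    destruct (state_valid _ _ U region body core nxt s0 A1 A3 v (N v) Uv) as [rv bv].
    destruct (hcore _ rv) as [cD [fD [sD [tD _]]]].
    split; [apply hN; auto|]. repeat (split; [assumption|]).
    intros w cw. assert (bw := sD w cw).
    assert (Uw : U w).
    { assert (K := state_sub _ _ U region body core nxt s0 A1 A3 A4 v 0 (N v) w Uv
        (Nat.le_0_l _) bw). eapply linked_tgt; exact K. }
    destruct (settles_agree _ _ U region body core nxt s0 A1 A2 A3 A4 v (N v) w Uv (hN v Uv) bw cw)
      as [sw E].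
    split; [apply Uw|]. split; [destruct Uw; congruence|].
    rewrite (settles_unique _ _ _ _ _ _ _ _ (hN w Uw) sw). exact (f_equal core E).
Qed.

End Pieces.

(** * Growing a spanning tree with finite fundamental cuts *)

Section SpanningTree.
Variable H : graph.
Hypothesis sep : forall x y : H, x <> y ->
  exists Z : H -> Prop, Z x /\ ~ Z y /\ finite_boundary H Z.
Variables (r : H) (d : H -> nat).
Hypothesis d_root : forall v, d v = 0 -> v = r.
Hypothesis d_pred : forall v, 0 < d v -> exists u, adj H u v /\ d u < d v.

Definition lowest (B : H -> Prop) t := B t /\ forall x, B x -> d t <= d x.

(* The measure behind termination: either a lowest vertex is lost, or the root
   gets closer to the lowest vertices. *)
Definition progress (B : H -> Prop) (b : H) (D : H -> Prop) (c : H) :=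
  (exists t, lowest B t /\ ~ D t) \/
  (exists t m, lowest B t /\ walk H D m c t /\
     forall n t', lowest B t' -> walk H B n b t' -> m < n).

Definition branch (s : (H -> Prop) * H) :=
  conn H (fst s) /\ finite_boundary H (fst s) /\ fst s (snd s).

Lemma lowest_exists B v : B v -> exists t, lowest B t.
Proof.
  intros Bv. destruct (least_nat (fun n => exists t, B t /\ d t = n)) as [n [[t [Bt <-]] hn]].
  { exists (d v), v. auto. }
  exists t. split; [assumption|]. intros x Bx.
  destruct (le_lt_dec (d t) (d x)) as [|lt]; [assumption|]. destruct (hn _ lt). eauto.
Qed.

(** Prescribe the vertices after [b] on a shortest walk from [b] to a lowest vertex [t]. The piece
    containing them gets the first one as root and is closer to [t]; every other piece loses [t]. *)
Lemma split_branch B b : branch (B, b) ->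
  exists f : H -> (H -> Prop) * H, forall v, B v -> v <> b ->
    branch (f v) /\ fst (f v) v /\ adj H b (snd (f v)) /\
    progress B b (fst (f v)) (snd (f v)) /\
    forall w, fst (f v) w -> B w /\ w <> b /\ f w = f v.
Proof.
  intros [cB [fB Bb]]. simpl in *.
  destruct (least_nat (fun n => exists t, lowest B t /\ walk H B n b t))
    as [n [[t [lt w]] hn]].
  { destruct (lowest_exists B b Bb) as [t lt].
    destruct (cB b t Bb (proj1 lt)) as [n w]. eauto. }
  assert (min : forall k t', lowest B t' -> walk H B k b t' -> n <= k).
  { intros k t' l' w'. destruct (le_lt_dec n k) as [|lk]; [assumption|].
    destruct (hn k lk). eauto. }
  clear hn.
  (* If [n = 0], then [b] itself is lowest and every piece loses it. Otherwise [p] follows [b] on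
     the shortest walk, whose remaining length is [m]. *)
  assert (X : exists (piece : H -> H -> Prop) (p : H),
    (n = 0 \/ adj H b p /\ exists m, S m = n /\ piece p t /\ walk H (piece p) m p t
      /\ B p /\ p <> b) /\
    forall v, B v -> v <> b ->
      piece v v /\ conn H (piece v) /\ finite_boundary H (piece v) /\ touches H b (piece v) /\
      forall w, piece v w -> B w /\ w <> b /\ piece w = piece v).
  { inversion w as [x Bx E1 E2 E3|m x p z Bx e w' E1 E2 E3]; subst.
    - destruct (classic (exists p, B p /\ p <> t)) as [[p [Bp np]]|no].
      (* Any [p] serves here; it only fills the list of prescribed vertices. *)
      + destruct (piece_partition H sep t B [p] p cB fB Bb) as [piece [_ hp]].
        * now left.
        * intros x [<-|[]]. apply linked_refl. split; congruence.
        * exists piece, p. auto.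
      + exists (fun _ _ => True), t. split; [auto|]. intros v Bv nv. destruct no. eauto.
    - destruct (walk_avoid _ _ b _ _ _ w') as [w2|[k [le w2]]].
      2:{ specialize (min k t lt w2). lia. }
      destruct (walk_support _ _ _ _ _ w2) as [W [W1 [W2 [W3 W4]]]].
      destruct (piece_partition H sep b B W p cB fB Bb W2 W1) as [piece [h1 h2]].
      exists piece, p. split; [|exact h2]. right. split; [assumption|].
      exists m. assert (S1 := walk_src _ _ _ _ _ w2). destruct S1.
      repeat split; auto. }
  destruct X as [piece [p [hp hpiece]]].
  (* The root depends only on the piece as a set, so all vertices of a piece get the same branch. *)
  destruct (choice_fun _ _ (fun D c =>
    touches H b D -> D c /\ adj H b c /\ (D p -> n <> 0 -> c = p))) as [root hroot].
  { intros D. destruct (classic (touches H b D)) as [[s [Ds es]]|nt].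
    2:{ exists b. intros h. contradiction. }
    destruct (classic (D p /\ n <> 0)) as [[Dp n0]|nD].
    - exists p. intros _. destruct hp as [hp|[hp _]]; [contradiction|auto].
    - exists s. intros _. split; [assumption|]. split; [now apply adj_sym|]. tauto. }
  exists (fun v => (piece v, root (piece v))). simpl. intros v Bv nv.
  destruct (hpiece v Bv nv) as [vv [cv [fv [tv hw]]]].
  destruct (hroot _ tv) as [h1 [h2 h3]].
  split; [now repeat split|]. split; [assumption|]. split; [assumption|]. split.
  - destruct hp as [n0|[_ [m [hm [pt [wp [Bp np]]]]]]].
    + left. exists t. split; [assumption|]. intros vt. destruct (hw t vt) as [_ [nb _]].
      subst n. inversion w. congruence.
    + destruct (classic (piece v p)) as [vp|nvp].
      * right. exists t, m. split; [assumption|].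
        destruct (hw p vp) as [_ [_ E]]. split.
        -- rewrite h3 by (auto; lia). now rewrite <- E.
        -- intros k t' l' w'. specialize (min k t' l' w'). lia.
      * left. exists t. split; [assumption|]. intros vt. apply nvp.
        destruct (hw t vt) as [_ [_ E]]. destruct (hpiece p Bp np) as [pp [_ [_ [_ hq]]]].
        destruct (hq t pt) as [_ [_ E']]. now rewrite <- E, E'.
  - intros x vx. destruct (hw x vx) as [h4 [h5 E]]. rewrite E. auto.
Qed.

(** A vertex of [B] on level [m], unless it is [r], has a neighbour on a lower level, hence outside
    [B]: it is an end of a boundary edge. *)
Lemma lowest_level_finite B m : finite_boundary H B -> (forall x, B x -> m <= d x) ->
  exists l, forall t, B t -> d t = m -> In t l.
Proof.
  intros [l hl] low. exists (r :: map fst l). intros t Bt dt.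
  destruct (d t) as [|k] eqn:E.
  - left. symmetry. now apply d_root.
  - right. destruct (d_pred t) as [u [e lt]]; [lia|].
    apply in_map_iff. exists (t, u). split; [reflexivity|]. apply hl.
    repeat split; auto using adj_sym. intros Bu. specialize (low u Bu). lia.
Qed.

(* Induction on the lowest level, then on the number of lowest vertices, then on
   their distance to the root. *)
Lemma no_endless_progress v (B : nat -> H -> Prop) (b : nat -> H) :
  (forall i, branch (B i, b i) /\ B i v /\ (forall x, B (S i) x -> B i x) /\
             progress (B i) (b i) (B (S i)) (b (S i))) -> False.
Proof.
  intros hB.
  (* [k] counts the levels from [m] up to that of [v]; at [k = 0] the vertex [v] would lie below all
     of [B i]. *)
  assert (low : forall k m, m + k = S (d v) ->
    forall i, (forall x, B i x -> m <= d x) -> False).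
  2:{ apply (low (S (d v)) 0 eq_refl 0). intros; lia. }
  induction k as [|k IHk]; intros m hm i hi.
  { destruct (hB i) as [_ [Bv _]]. specialize (hi v Bv). lia. }
  destruct (hB i) as [[_ [fB _]] _].
  destruct (lowest_level_finite (B i) m fB hi) as [L hL]. clear fB.
  remember (length L) as c eqn:hc.
  revert L hc i hi hL. induction c as [c IHc] using lt_wf_ind. intros L hc i hi hL.
  destruct (classic (exists t, B i t /\ d t = m)) as [[t [Bt dt]]|no].
  2:{ apply (IHk (S m) ltac:(lia) i). intros x Bx. specialize (hi x Bx).
      destruct (Nat.eq_dec (d x) m); [destruct no; eauto|lia]. }
  destruct (hB i) as [[cB [_ Bb]] _].
  destruct (cB (b i) t Bb Bt) as [n w]. simpl in w. clear cB Bb.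
  revert i hi hL t Bt dt w. induction n as [n IHn] using lt_wf_ind.
  intros i hi hL t Bt dt w.
  destruct (hB i) as [_ [_ [sub pr]]].
  assert (lvl : forall t', lowest (B i) t' -> d t' = m).
  { intros t' [B1 h1]. specialize (h1 t Bt). specialize (hi t' B1). lia. }
  assert (lt : lowest (B i) t).
  { split; [assumption|]. intros x Bx. rewrite dt. auto. }
  (* A lost lowest vertex shortens the list [L]; otherwise the walk from the root to a lowest vertex
     gets shorter. *)
  destruct pr as [[t' [l' nt]]|[t' [k' [l' [w' sm]]]]].
  - set (eqd := fun x y : H => excluded_middle_informative (x = y)).
    apply (IHc (length (remove eqd t' L))) with (L := remove eqd t' L) (i := S i); auto.
    + subst c. apply remove_length_lt, hL; [apply l'|auto].
    + intros x Bx dx. apply in_in_remove; [congruence|]. auto.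
  - apply (IHn k' (sm n t lt w)) with (i := S i) (t := t'); auto.
    eapply walk_tgt; eauto.
Qed.

Hypothesis H_conn : conn H (fun _ => True).

(** [desc u] is the branch rooted at [u], [par u] the root of the branch split just before, and
    [rank] the round of settling. The last clause says that the only tree edge crossing [desc u] is
    the one from [u] to [par u]. *)
Lemma finite_cut_tree : exists (par : H -> H) (rank : H -> nat) (desc : H -> H -> Prop),
  forall u, u <> r ->
    adj H (par u) u /\ rank (par u) < rank u /\
    desc u u /\ ~ desc u (par u) /\ finite_boundary H (desc u) /\
    forall w, w <> r -> w <> u -> (desc u w <-> desc u (par w)).
Proof.
  destruct (choice_fun _ _ (fun s f => branch s -> forall v, fst s v -> v <> snd s ->
    branch (f v) /\ fst (f v) v /\ adj H (snd s) (snd (f v)) /\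
    progress (fst s) (snd s) (fst (f v)) (snd (f v)) /\
    forall w, fst (f v) w -> fst s w /\ w <> snd s /\ f w = f v)) as [nxt hnxt].
  { intros [B b]. destruct (classic (branch (B, b))) as [br|nb].
    - destruct (split_branch B b br) as [f hf]. now exists f.
    - exists (fun _ => (B, b)). intros h. contradiction. }
  set (U := fun _ : H => True).
  set (s0 := fun _ : H => ((fun _ : H => True), r)).
  set (body := fun s : (H -> Prop) * H => fst s).
  set (core := fun (s : (H -> Prop) * H) v => v = snd s).
  assert (A1 : forall v, U v -> branch (s0 v) /\ body (s0 v) v).
  { intros v _. split; [|exact I]. split; [exact H_conn|]. split; [|exact I].
    exists nil. intros x y [_ [_ h]]. now destruct h. }
  assert (A2 : forall v w, U v -> body (s0 v) w -> s0 w = s0 v) by auto.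
  assert (A3 : forall s v, branch s -> body s v -> ~ core s v ->
    branch (nxt s v) /\ body (nxt s v) v).
  { intros s v br bv nc. destruct (hnxt s br v bv nc) as [h1 [h2 _]]. auto. }
  assert (A4 : forall s v w, branch s -> body s v -> ~ core s v ->
    body (nxt s v) w -> body s w /\ ~ core s w /\ nxt s w = nxt s v).
  { intros s v w br bv nc bw. destruct (hnxt s br v bv nc) as [_ [_ [_ [_ h]]]]. auto. }
  pose (st := state _ _ core nxt s0).
  assert (val : forall v n, branch (st v n) /\ body (st v n) v).
  { intros v n. apply (state_valid _ _ U branch body core nxt s0 A1 A3). exact I. }
  assert (term : forall v, exists n, settles _ _ core nxt s0 v n).
  { intros v. apply settles_ex. apply NNPP. intros N.
    apply (no_endless_progress v (fun i => fst (st v i)) (fun i => snd (st v i))).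
    intros i. destruct (val v i) as [br bv]. rewrite <- surjective_pairing.
    assert (nc : ~ core (st v i) v) by (intros c; apply N; eauto).
    assert (E : st v (S i) = nxt (st v i) v) by (apply state_S, nc). rewrite E.
    destruct (hnxt _ br v bv nc) as [_ [_ [_ [h4 h5]]]].
    split; [assumption|]. split; [assumption|]. split; [|assumption].
    intros x hx. now apply h5. }
  destruct (choice_fun _ _ _ term) as [N hN]. clear term.
  assert (uns : forall v, unsettled _ _ core nxt s0 v (N v)) by (intros; apply hN).
  assert (top : forall v, v = snd (st v (N v))) by (intros; apply hN).
  assert (agree : forall v n w, unsettled _ _ core nxt s0 v n -> body (st v n) w ->
    st w n = st v n /\ unsettled _ _ core nxt s0 w n).
  { intros. apply (state_agree _ _ U branch body core nxt s0 A1 A2 A3 A4); auto. exact I. }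
  assert (mono : forall v m n w, m <= n -> body (st v n) w -> body (st v m) w).
  { intros. eapply (state_sub _ _ U branch body core nxt s0 A1 A3 A4); eauto. exact I. }
  assert (later : forall v n, unsettled _ _ core nxt s0 v n -> n <= N v).
  { intros v n un. destruct (le_lt_dec n (N v)) as [|lt]; [assumption|].
    destruct (un _ lt (top v)). }
  assert (pos : forall v, v <> r -> exists n, N v = S n).
  { intros v nv. destruct (N v) eqn:E; [|eauto]. assert (T := top v).
    rewrite E in T. destruct (nv T). }
  set (par := fun v => snd (st v (pred (N v)))).
  (* The parent lies in the branch of [v] at round [n] and is its root, so it shares the history of
     [v] and settles there. *)
  assert (parN : forall v n, N v = S n -> N (par v) = n /\ st (par v) n = st v n).
  { intros v n E. unfold par. rewrite E. simpl.
    assert (un : unsettled _ _ core nxt s0 v n).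
    { intros m lt. apply uns. lia. }
    destruct (val v n) as [[_ [_ hb]] _].
    destruct (agree v n _ un hb) as [E1 u1]. split; [|assumption].
    eapply settles_unique; [apply hN|]. split; [|assumption].
    fold (st (snd (st v n)) n). now rewrite E1. }
  exists par, N, (fun u => body (st u (N u))). intros u nu.
  destruct (pos u nu) as [n E]. destruct (parN u n E) as [E1 E2].
  assert (nc : ~ core (st u n) u) by (apply uns; lia).
  destruct (val u n) as [br bu].
  destruct (hnxt _ br u bu nc) as [_ [_ [h3 [_ h5]]]].
  assert (ES : st u (N u) = nxt (st u n) u) by (rewrite E; apply state_S, nc).
  split; [|split; [lia|split; [apply val|split; [|split]]]].
  - rewrite <- ES, <- top in h3. unfold par. now rewrite E.
  - rewrite ES. unfold par. rewrite E. simpl. intros hb. now apply (h5 _ hb).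
  - apply val.
  (* Two distinct vertices cannot be roots of one branch, so [w] in [desc u] settles strictly after
     [u], and its parent no earlier than [u]. Conversely [w] lies in the branch rooted at its
     parent, which is contained in [desc u]. *)
  - intros w nw nwu. destruct (pos w nw) as [k F]. destruct (parN w k F) as [F1 F2]. split.
    + intros bw. destruct (agree u (N u) w (uns u) bw) as [G1 G2].
      assert (le := later _ _ G2).
      assert (ne : N u <> N w).
      { intros h. apply nwu. rewrite (top w), <- h, G1. symmetry. apply top. }
      rewrite <- G1. apply mono with k; [lia|]. unfold par. rewrite F. apply val.
    + intros bp. destruct (agree u (N u) (par w) (uns u) bp) as [G1 G2].
      assert (le := later _ _ G2). rewrite <- G1.
      apply mono with (N (par w)); [assumption|]. rewrite F1, F2. apply val.
Qed.

End SpanningTree.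

(** * The tree of a parent function *)

Lemma last_default (A : Type) (l : list A) a d d' : last (a :: l) d = last (a :: l) d'.
Proof. revert a. induction l as [|b l IH]; intros a; [reflexivity|]. apply (IH b). Qed.

Section ParentTree.
Variables (H : graph) (r : H) (par : H -> H) (rank : H -> nat) (desc : H -> H -> Prop).
Hypothesis data : forall u, u <> r ->
  adj H (par u) u /\ rank (par u) < rank u /\
  desc u u /\ ~ desc u (par u) /\ finite_boundary H (desc u) /\
  forall w, w <> r -> w <> u -> (desc u w <-> desc u (par w)).

Definition parent_adj (u v : H) := (u <> r /\ v = par u) \/ (v <> r /\ u = par v).

Lemma parent_adj_sym u v : parent_adj u v -> parent_adj v u.
Proof. unfold parent_adj. tauto. Qed.

Lemma parent_adj_irrefl u : ~ parent_adj u u.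
Proof.
  intros [[n e]|[n e]]; destruct (data u n) as [_ [lt _]]; rewrite <- e in lt; lia.
Qed.

Definition parent_tree := Graph parent_adj parent_adj_sym parent_adj_irrefl.

(** Names a tree edge, in either orientation, by its child end [u]. *)
Definition edge_of (u t1 t2 : H) :=
  u <> r /\ ((t1 = u /\ t2 = par u) \/ (t1 = par u /\ t2 = u)).

(** Membership in [desc u] changes only across the edge from [u] to [par u], which is deleted. *)
Lemma side_desc u t1 t2 s x : edge_of u t1 t2 ->
  side parent_tree t1 t2 s x -> (desc u s <-> desc u x).
Proof.
  intros [nu e] S. induction S as [s x [a ne]| |]; [|tauto|tauto].
  destruct (data u nu) as [_ [_ [_ [_ [_ inv]]]]].
  assert (K : forall w, w <> r -> ((s = w /\ x = par w) \/ (s = par w /\ x = w)) ->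
    w <> u).
  { intros w nw h ->. apply ne.
    destruct e as [[-> ->]|[-> ->]], h as [[-> ->]|[-> ->]]; auto. }
  destruct a as [[n ->]|[n ->]].
  - apply inv; auto.
  - symmetry. apply inv; auto.
Qed.

Lemma parent_tree_bridge t1 t2 : adj parent_tree t1 t2 -> ~ side parent_tree t1 t2 t1 t2.
Proof.
  intros a S.
  assert (E : exists u, edge_of u t1 t2).
  { destruct a as [[n e]|[n e]]; [exists t1|exists t2]; split; auto. }
  destruct E as [u E]. assert (K := side_desc u t1 t2 t1 t2 E S).
  destruct E as [nu [[-> ->]|[-> ->]]]; destruct (data u nu) as [_ [_ [h1 [h2 _]]]]; tauto.
Qed.

Lemma chain_side x0 z y (l : list parent_tree) :
  chain parent_tree (y :: l) -> ~ In x0 (y :: l) ->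
  side parent_tree x0 z y (last (y :: l) y).
Proof.
  revert y. induction l as [|y' l IH]; intros y c ni; [apply rt_refl|].
  destruct c as [a c]. apply rt_trans with y'.
  - apply rt_step. split; [assumption|].
    intros [[h _]|[_ h]]; apply ni; simpl; auto.
  - assert (K := IH y' c (fun h => ni (or_intror h))).
    change (last (y :: y' :: l) y) with (last (y' :: l) y).
    now rewrite (last_default _ l y' y y').
Qed.

(** The rest of a cycle would join the ends of its closing edge, but every edge is a bridge. *)
Lemma parent_tree_acyclic l : ~ is_cycle parent_tree l.
Proof.
  intros [len [nd [c [x0 [hd a]]]]].
  destruct l as [|x [|y l]]; simpl in len; try lia.
  injection hd as ->. destruct c as [e c].
  assert (nd0 : ~ In x0 (y :: l)) by (now inversion nd).
  assert (nd1 : ~ In y l) by (inversion nd as [|? ? _ nd']; now inversion nd').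
  set (z := last (x0 :: y :: l) x0) in *.
  assert (Ez : z = last (y :: l) y) by apply (last_default _ l y x0 y).
  (* Length at least 3 makes [z] differ from [y], so the step from [x0] to [y] avoids the deleted
     edge. *)
  assert (zl : In z l).
  { rewrite Ez. destruct l as [|b l]; [simpl in len; lia|].
    clear. revert b. induction l as [|b' l IH]; intros b; [now left|]. right. apply IH. }
  apply (parent_tree_bridge x0 z (adj_sym _ _ _ a)).
  apply rt_trans with y.
  - apply rt_step. split; [assumption|].
    intros [[_ h]|[h _]]; [apply nd1; now rewrite h|].
    apply nd0. right. now rewrite h.
  - rewrite Ez at 2. now apply chain_side.
Qed.

Lemma parent_tree_is_tree : is_tree parent_tree.
Proof.
  split; [|exact parent_tree_acyclic]. split; [exact (inhabits r)|].
  assert (K : forall n v, rank v = n -> reach parent_tree v r /\ reach parent_tree r v).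
  { induction n as [n IH] using lt_wf_ind. intros v E.
    destruct (classic (v = r)) as [->|nv]; [split; apply rt_refl|].
    destruct (data v nv) as [_ [lt _]].
    destruct (IH (rank (par v)) ltac:(lia) (par v) eq_refl) as [h1 h2].
    split; eapply rt_trans; eauto; apply rt_step; [left|right]; auto. }
  intros x y. eapply rt_trans; eapply K; reflexivity.
Qed.

End ParentTree.

(** * The graph of omega-edge blocks *)

Section Blocks.
Variable G : graph.

Lemma omega_equiv_alt (x y : G) :
  omega_equiv G x y <-> forall F, clos_refl_trans G (adj_minus G F) x y.
Proof.
  split.
  - intros h F. apply NNPP. intros n. apply h. now exists F.
  - intros h [F n]. auto.
Qed.

Lemma adj_minus_reach_sym F (x y : G) :
  clos_refl_trans G (adj_minus G F) x y -> clos_refl_trans G (adj_minus G F) y x.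
Proof.
  induction 1 as [x y [a n]| |]; [|apply rt_refl|eapply rt_trans; eauto].
  apply rt_step. split; [now apply adj_sym|]. unfold in_edges in *. tauto.
Qed.

(** Classes as predicates: extensionality and proof irrelevance turn equivalence into equality of
    vertices. *)
Definition block := {P : G -> Prop | exists x, P = omega_equiv G x}.
Definition block_of (x : G) : block := exist _ (omega_equiv G x) (ex_intro _ x eq_refl).

Lemma block_of_surj (q : block) : exists x, block_of x = q.
Proof. destruct q as [P [x ->]]. now exists x. Qed.

Lemma block_of_eq x y : block_of x = block_of y <-> omega_equiv G x y.
Proof.
  split.
  - intros E. apply (f_equal (@proj1_sig _ _)) in E. simpl in E. rewrite E.
    apply omega_equiv_alt. intros F. apply rt_refl.
  - intros h. assert (E : omega_equiv G x = omega_equiv G y).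
    { apply set_ext. intros z. rewrite omega_equiv_alt in *. rewrite omega_equiv_alt.
      split; intros k F; eapply rt_trans; eauto using adj_minus_reach_sym. }
    unfold block_of. apply eq_sig_hprop; [|exact E].
    intros. apply proof_irrelevance.
Qed.

Definition block_adj (p q : block) :=
  p <> q /\ exists x y, block_of x = p /\ block_of y = q /\ adj G x y.

Lemma block_adj_sym p q : block_adj p q -> block_adj q p.
Proof.
  intros [n [x [y [h1 [h2 a]]]]]. split; [congruence|].
  exists y, x. auto using adj_sym.
Qed.

Lemma block_adj_irrefl p : ~ block_adj p p.
Proof. now intros [n _]. Qed.

Definition block_graph := Graph block_adj block_adj_sym block_adj_irrefl.

Lemma block_graph_conn : (forall x y, reach G x y) -> conn block_graph (fun _ => True).
Proof.
  intros c p q _ _. destruct (block_of_surj p) as [x <-]. destruct (block_of_surj q) as [y <-].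
  specialize (c x y). induction c as [x y a|x|x y z _ IH1 _ IH2].
  - destruct (classic (block_of x = block_of y)) as [E|n].
    + rewrite E. now apply linked_refl.
    + apply linked_adj; auto. split; eauto.
  - now apply linked_refl.
  - eapply linked_trans; eauto.
Qed.

(** If [F] separates [x] from [y], take the blocks meeting the component [R] of [x] in [G - F]. No
    block is split by [F], so all edges of this cut lie in [F]. *)
Lemma blocks_separated (p q : block) : p <> q ->
  exists Z : block -> Prop, Z p /\ ~ Z q /\
    finite_pairs (fun x y => adj G x y /\ Z (block_of x) /\ ~ Z (block_of y)).
Proof.
  intros n. destruct (block_of_surj p) as [x <-]. destruct (block_of_surj q) as [y <-].
  assert (S : finitely_separable G x y).
  { apply NNPP. intros h. apply n. now apply block_of_eq. }
  destruct S as [F nF].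
  set (R := clos_refl_trans G (adj_minus G F)) in *.
  exists (fun q => exists z, block_of z = q /\ R x z).
  assert (K : forall v, (exists z, block_of z = block_of v /\ R x z) <-> R x v).
  { intros v. split; [|eauto]. intros [z [E h]]. apply block_of_eq in E.
    rewrite omega_equiv_alt in E. eapply rt_trans; [exact h|apply E]. }
  split; [|split].
  - exists x. split; [reflexivity|apply rt_refl].
  - now rewrite K.
  (* Reversed pairs are added because [F] may list an edge in either direction. *)
  - exists (F ++ map (fun e => (snd e, fst e)) F). intros u v [a [h1 h2]].
    rewrite K in h1, h2. apply in_or_app.
    assert (i : in_edges G F u v).
    { apply NNPP. intros ni. apply h2. eapply rt_trans; [exact h1|]. now apply rt_step. }
    destruct i as [i|i]; [now left|right]. apply in_map_iff. now exists (v, u).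
Qed.

Lemma block_graph_separated (p q : block_graph) : p <> q ->
  exists Z : block_graph -> Prop, Z p /\ ~ Z q /\ finite_boundary block_graph Z.
Proof.
  intros n. destruct (blocks_separated p q n) as [Z [Zp [nZ [l hl]]]].
  exists Z. split; [assumption|]. split; [assumption|].
  exists (map (fun e => (block_of (fst e), block_of (snd e))) l).
  intros a b [[_ [x [y [<- [<- e]]]]] [h1 h2]].
  apply in_map_iff. exists (x, y). auto.
Qed.

(** Each edge of the block graph stands for finitely many edges of [G], since its two blocks are
    separated by a finite cut. *)
Lemma finite_cut_lift (Z : block -> Prop) : finite_boundary block_graph Z ->
  finite_pairs (fun x y => adj G x y /\ Z (block_of x) /\ ~ Z (block_of y)).
Proof.
  intros fZ. apply finite_pairs_fibres with (f := block_of) (g := block_of) (2 := fZ).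
  - intros x y [a [h1 h2]]. split; [|now split].
    split; [intros E; apply h2; now rewrite <- E|eauto].
  - intros p q [[n _] _]. destruct (blocks_separated p q n) as [Y [Yp [nY fY]]].
    apply finite_pairs_sub with (2 := fY). intros x y [[a _] [-> ->]]. auto.
Qed.

End Blocks.

(** * The decomposition tree on the blocks *)

Theorem theorem2p4 :
  forall G : graph, connected G ->
  exists (T : graph) (part : G -> T),
    tree_cut_decomposition G T part /\
    @finite_adhesion G T part /\
    (* the parts are exactly the omega-edge blocks *)
    (forall x y : G, part x = part y <-> @omega_equiv G x y) /\
    (* every tree edge t1t2 is witnessed by an edge of G between X_t1, X_t2 *)
    (forall t1 t2 : T, adj T t1 t2 ->
       exists x y : G, part x = t1 /\ part y = t2 /\ adj G x y).
Proof.
  intros G [[g] cG].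
  set (H := block_graph G). set (r := block_of G g : H).
  assert (cH := block_graph_conn G cG).
  (* [d] is the distance to [r] in the block graph. *)
  destruct (choice_fun H nat (fun v n => walk H (fun _ => True) n v r /\
    forall m, m < n -> ~ walk H (fun _ => True) m v r)) as [d hd].
  { intros v. apply least_nat. exact (cH v r I I). }
  destruct (finite_cut_tree H (block_graph_separated G) r d) as [par [rank [desc data]]].
  - intros v E. destruct (hd v) as [w _]. rewrite E in w. now inversion w.
  - intros v lt. destruct (hd v) as [w _]. inversion w as [|n x u z _ a w' E]; [lia|].
    subst. exists u. split; [now apply adj_sym|].
    destruct (le_lt_dec (d u) n); [lia|]. destruct (hd u) as [_ h]. now destruct (h n).
  - exact cH.
  - exists (parent_tree H r par rank desc data), (block_of G).
    split; [|split; [|split]].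
    + split; [apply parent_tree_is_tree|apply block_of_surj].
    + intros t1 t2 a.
      assert (K : exists u, edge_of H r par u t1 t2).
      { destruct a as [[n e]|[n e]]; [exists t1|exists t2]; split; auto. }
      destruct K as [u K].
      assert (K1 : forall x, side _ t1 t2 t1 x -> (desc u t1 <-> desc u x)).
      { intros x. exact (side_desc H r par rank desc data u t1 t2 t1 x K). }
      assert (K2 : forall x, side _ t1 t2 t2 x -> (desc u t2 <-> desc u x)).
      { intros x. exact (side_desc H r par rank desc data u t1 t2 t2 x K). }
      (* The sides of the tree edge lie inside and outside [desc u], so the adhesion set lies in the
         lifted cut, up to orientation. *)
      destruct K as [nu e]. destruct (data u nu) as [_ [_ [h1 [h2 [fd _]]]]].
      apply finite_cut_lift in fd.
      destruct e as [[-> ->]|[-> ->]].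
      * apply finite_pairs_sub with (2 := fd). intros x y [axy [s1 s2]].
        apply K1 in s1. apply K2 in s2. tauto.
      * apply finite_pairs_sub with (2 := finite_pairs_swap _ _ _ fd).
        intros x y [axy [s1 s2]]. apply K1 in s1. apply K2 in s2.
        assert (ayx := adj_sym _ _ _ axy). tauto.
    + apply block_of_eq.
    + intros t1 t2 a.
      assert (e : adj H t1 t2).
      { destruct a as [[n ->]|[n ->]]; [apply adj_sym|]; now apply data. }
      destruct e as [_ e]. exact e.
Qed.
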